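(* Let $\mathcal{X}=(X,\cdot,\mathbin{:})$ be a left regular $q$-magma coalgebra over a field $k$, let $x^y:=(X\otimes\epsilon)\circ\overline{G}_{\mathcal{X}}^{-1}(x\otimes y)$ and ${}^xy:=y_{(2)}\mathbin{:}x^{y_{(1)}}$, and let $s\colon X\otimes X\to X\otimes X$ be the map $s(x\otimes y):={}^{x_{(2)}}y_{(2)}\otimes {x_{(1)}}^{y_{(1)}}$. Then $s$ is a left non-degenerate coalgebra endomorphism of $X\otimes X$.
   Context: All vector spaces, maps and tensor products are over $k$ (maps are linear); Sweedler notation $\Delta(x)=x_{(1)}\otimes x_{(2)}$ is used; $\epsilon$ is the counit; $X^2=X\otimes X$; $X^{\mathrm{cop}}$ is the opposite coalgebra; $X$ inside a tensor product of maps denotes $\mathrm{id}_X$. $q$-magma coalgebras: let $X$ be a coalgebra and let $x\otimes y\mapsto x\cdot y$ and $x\otimes y\mapsto x\mathbin{:}y$ be linear maps $X^2\to X$ with $\epsilon(x\cdot y)=\epsilon(x\mathbin{:}y)=\epsilon(x)\epsilon(y)$. The triple $(X,\cdot,\mathbin{:})$ is a $q$-magma coalgebra if $h\colon X\otimes X^{\mathrm{cop}}\to X^{\mathrm{cop}}\otimes X$, $h(x\otimes y):=y_{(1)}\mathbin{:}x_{(2)}\otimes x_{(1)}\cdot y_{(2)}$, is a coalgebra morphism. Let $\overline{G}_{\mathcal{X}}\colon X^2\to X^2$ be $\overline{G}_{\mathcal{X}}(x\otimes y):=x\cdot y_{(1)}\otimes y_{(2)}$. The $q$-magma coalgebra is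 left regular if $\overline{G}_{\mathcal{X}}$ is invertible. For a coalgebra endomorphism $s$ of $X^2$ put $s_2:=(\epsilon\otimes X)\circ s$ and $G_s(x\otimes y):=s_2(x\otimes y_{(1)})\otimes y_{(2)}$; $s$ is left non-degenerate if $G_s\colon X^2\to X^2$ is invertible. *)

(* Defs.v *)
From HB Require Import structures.
From mathcomp Require Import all_boot all_algebra.
From mathcomp Require Import generic_quotient.
From mathcomp Require Import boolp classical_sets.

Set Implicit Arguments.
Unset Strict Implicit.
Unset Printing Implicit Defensive.

Import GRing.Theory.
Local Open Scope ring_scope.
Local Open Scope quotient_scope.

Reserved Notation "U ⊗ V" (at level 40, left associativity).
Reserved Notation "\sw_ ( u # v <- t ) F"
  (at level 41, u name, v name, t at level 200, F at level 41,
   format "'[' \sw_ ( u  #  v  <-  t ) '/  '  F ']'").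

(* Tensor product of two arbitrary (possibly infinite-dimensional) k-vector
   spaces: finite formal sums of pairs, modulo the congruence generated by the
   usual relations. *)
Section TensorDef.
Variables (k : fieldType) (U V : lmodType k).

Inductive teq : seq (U * V) -> seq (U * V) -> Prop :=
| teq_refl s : teq s s
| teq_sym s t : teq s t -> teq t s
| teq_trans s t r : teq s t -> teq t r -> teq s r
| teq_cat s s' t t' : teq s s' -> teq t t' -> teq (s ++ t) (s' ++ t')
| teq_comm s t : teq (s ++ t) (t ++ s)
| teq_zero v : teq [:: (0, v)] [::]
| teq_addl u u' v : teq [:: (u + u', v)] [:: (u, v); (u', v)]
| teq_addr u v v' : teq [:: (u, v + v')] [:: (u, v); (u, v')]
| teq_scale a u v : teq [:: (a *: u, v)] [:: (u, a *: v)].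

Definition teqb : rel (seq (U * V)) := fun s t => `[< teq s t >].

Lemma teqb_equiv : equiv_class_of teqb.
Proof.
split=> [s|s t|s t r]; first exact/asboolP/teq_refl.
  by apply/idP/idP=> /asboolP h; apply/asboolP/teq_sym.
by move=> /asboolP h1 /asboolP h2; apply/asboolP; apply: teq_trans h1 h2.
Qed.

Canonical teqb_equiv_rel := EquivRelPack teqb_equiv.

Definition tensor := {eq_quot teqb}.

HB.instance Definition _ := Quotient.on tensor.
HB.instance Definition _ := Choice.on tensor.

Definition tsum (s : seq (U * V)) : tensor := \pi_tensor s.

Lemma tsumP s t : tsum s = tsum t <-> teq s t.
Proof.
split=> [/eqmodP /asboolP //|h]; apply/eqmodP; exact/asboolP.
Qed.

Lemma tsumK t : tsum (repr t) = t.
Proof. exact: reprK. Qed.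

Lemma teq_repr s : teq (repr (tsum s)) s.
Proof. by apply/tsumP; rewrite tsumK. Qed.

Definition tens (u : U) (v : V) : tensor := tsum [:: (u, v)].

Let sc (a : k) (s : seq (U * V)) := [seq (a *: p.1, p.2) | p <- s].

Lemma teq_sc a s t : teq s t -> teq (sc a s) (sc a t).
Proof.
elim=> {s t}.
- by move=> s; apply: teq_refl.
- by move=> s t _; apply: teq_sym.
- by move=> s t r _ h1 _; apply: teq_trans.
- by move=> s s' t t' _ h1 _ h2; rewrite /sc !map_cat; apply: teq_cat.
- by move=> s t; rewrite /sc !map_cat; apply: teq_comm.
- by move=> v; rewrite /sc /= scaler0; apply: teq_zero.
- by move=> u u' v; rewrite /sc /= scalerDr; apply: teq_addl.
- by move=> u v v'; rewrite /sc /=; apply: teq_addr.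
- move=> b u v; rewrite /sc /= scalerA mulrC -scalerA; exact: teq_scale.
Qed.

Definition tadd (x y : tensor) := tsum (repr x ++ repr y).
Definition tscale a (x : tensor) := tsum (sc a (repr x)).
Definition topp (x : tensor) := tscale (-1) x.

Lemma tadd_sum s t : tadd (tsum s) (tsum t) = tsum (s ++ t).
Proof. by apply/tsumP; apply: teq_cat; exact: teq_repr. Qed.

Lemma tscale_sum a s : tscale a (tsum s) = tsum (sc a s).
Proof. by apply/tsumP; apply: teq_sc; exact: teq_repr. Qed.

Lemma taddA : associative tadd.
Proof.
move=> x y z; rewrite -(tsumK x) -(tsumK y) -(tsumK z).
by rewrite !tadd_sum catA.
Qed.

Lemma taddC : commutative tadd.
Proof.
by move=> x y; rewrite /tadd; apply/tsumP; apply: teq_comm.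
Qed.

Lemma tadd0 : left_id (tsum [::]) tadd.
Proof. by move=> x; rewrite -(tsumK x) tadd_sum. Qed.

Lemma tscaleDl x a b : tscale (a + b) x = tadd (tscale a x) (tscale b x).
Proof.
rewrite -(tsumK x); elim: (repr x) => [|[u v] s IH].
  by rewrite !tscale_sum tadd0.
have -> : tsum ((u, v) :: s) = tadd (tens u v) (tsum s) by rewrite tadd_sum.
have D c y z : tscale c (tadd y z) = tadd (tscale c y) (tscale c z).
  by rewrite -(tsumK y) -(tsumK z) tadd_sum !tscale_sum tadd_sum /sc map_cat.
rewrite !D IH.
have -> : tscale (a + b) (tens u v) =
          tadd (tscale a (tens u v)) (tscale b (tens u v)).
  rewrite !tscale_sum tadd_sum /=; apply/tsumP; rewrite scalerDl.
  exact: teq_addl.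
rewrite -!taddA; congr (tadd _ _).
by rewrite taddA [tadd (tscale b _) _]taddC -taddA.
Qed.

Lemma tscale0 x : tscale 0 x = tsum [::].
Proof.
rewrite -(tsumK x) tscale_sum; elim: (repr x) => [//|[u v] s IH].
rewrite /= -cat1s -tadd_sum IH taddC tadd0; apply/tsumP.
by rewrite scale0r; apply: teq_zero.
Qed.

Lemma tscale1 : left_id 1 tscale.
Proof.
move=> x; rewrite -(tsumK x) tscale_sum; congr tsum.
by rewrite -[RHS]map_id; apply: eq_map => -[u v] /=; rewrite scale1r.
Qed.

Lemma taddN : left_inverse (tsum [::]) topp tadd.
Proof.
move=> x; rewrite /topp -{2}(tscale1 x) -tscaleDl addNr; exact: tscale0.
Qed.

HB.instance Definition _ := GRing.isZmodule.Build tensor taddA taddC tadd0 taddN.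

Lemma tscaleA a b x : tscale a (tscale b x) = tscale (a * b) x.
Proof.
rewrite -(tsumK x) !tscale_sum; congr tsum.
by rewrite /sc -map_comp; apply: eq_map => -[u v] /=; rewrite scalerA.
Qed.

Lemma tscaleDr : right_distributive tscale +%R.
Proof.
move=> c y z; rewrite -[LHS]/(tscale c (tadd y z)).
rewrite -[RHS]/(tadd (tscale c y) (tscale c z)).
by rewrite -(tsumK y) -(tsumK z) tadd_sum !tscale_sum tadd_sum /sc map_cat.
Qed.

HB.instance Definition _ := GRing.Zmodule_isLmodule.Build k tensor
  tscaleA tscale1 tscaleDr (fun x => fun a b => tscaleDl x a b).

End TensorDef.

Notation "U ⊗ V" := (tensor U V) : type_scope.
Notation "u ⊗ v" := (tens u v) : ring_scope.

Section TensorTheory.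
Variable k : fieldType.
Implicit Types U V W : lmodType k.

Definition bilin U V W (f : U -> V -> W) :=
  (forall v, linear (f^~ v)) /\ (forall u, linear (f u)).

Lemma linD U V (f : U -> V) : linear f -> {morph f : x y / x + y}.
Proof. by move=> h x y; have := h 1 x y; rewrite !scale1r. Qed.

Lemma lin0 U V (f : U -> V) : linear f -> f 0 = 0.
Proof.
by move=> h; have /eqP := linD h 0 0; rewrite addr0 -subr_eq0 opprD addNKr oppr_eq0
  => /eqP.
Qed.

Lemma linZ U V (f : U -> V) a : linear f -> {morph f : x / a *: x}.
Proof. by move=> h x; have := h a x 0; rewrite (lin0 h) !addr0. Qed.

Lemma linP U V (f : {linear U -> V}) : linear f.
Proof. exact: linearP. Qed.

Lemma tensDl U V (u u' : U) (v : V) : (u + u') ⊗ v = u ⊗ v + u' ⊗ v.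
Proof.
rewrite -[RHS]/(tadd (tens u v) (tens u' v)) tadd_sum; apply/tsumP.
exact: teq_addl.
Qed.

Lemma tensDr U V (u : U) (v v' : V) : u ⊗ (v + v') = u ⊗ v + u ⊗ v'.
Proof.
rewrite -[RHS]/(tadd (tens u v) (tens u v')) tadd_sum; apply/tsumP.
exact: teq_addr.
Qed.

Lemma tensZl U V a (u : U) (v : V) : (a *: u) ⊗ v = a *: (u ⊗ v).
Proof. by rewrite -[RHS]/(tscale a (tens u v)) tscale_sum. Qed.

Lemma tensZr U V a (u : U) (v : V) : u ⊗ (a *: v) = a *: (u ⊗ v).
Proof. by rewrite -tensZl; apply/tsumP/teq_sym/teq_scale. Qed.

Lemma bilin_tens U V : bilin (@tens k U V).
Proof.
by split=> w a x y; rewrite ?tensDl ?tensDr ?tensZl ?tensZr.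
Qed.

Lemma tsum_big U V (s : seq (U * V)) : tsum s = \sum_(p <- s) p.1 ⊗ p.2.
Proof.
elim: s => [|[u v] s IH]; first by rewrite big_nil.
by rewrite big_cons -IH -[RHS]/(tadd (tens u v) (tsum s)) tadd_sum.
Qed.

Lemma tensor_ind U V (P : U ⊗ V -> Prop) :
  P 0 -> (forall s t, P s -> P t -> P (s + t)) -> (forall u v, P (u ⊗ v)) ->
  forall t, P t.
Proof.
move=> P0 PD Pt t; rewrite -(tsumK t) tsum_big; exact: big_ind.
Qed.

Lemma linear_ext U V W (f g : U ⊗ V -> W) :
  linear f -> linear g -> (forall u v, f (u ⊗ v) = g (u ⊗ v)) -> f =1 g.
Proof.
move=> lf lg h; apply: tensor_ind => [|s t hs ht|//]; first by rewrite !lin0.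
by rewrite !linD // hs ht.
Qed.

(* Universal property: for bilinear f, [tlift f] is the unique linear map with
   tlift f (u ⊗ v) = f u v (see [tlift_tens], [tlift_linear], [linear_ext]). *)
Definition tlift U V W (f : U -> V -> W) (t : U ⊗ V) : W :=
  \sum_(p <- repr t) f p.1 p.2.

Lemma teq_big U V W (f : U -> V -> W) s t : bilin f -> teq s t ->
  \sum_(p <- s) f p.1 p.2 = \sum_(p <- t) f p.1 p.2.
Proof.
move=> [fl fr]; elim=> {s t} //.
- by move=> s t r _ -> _ ->.
- by move=> s s' t t' _ h _ h'; rewrite !big_cat /= h h'.
- by move=> s t; rewrite !big_cat /= addrC.
- by move=> v; rewrite big_seq1 big_nil /=; exact: (lin0 (fl v)).
- by move=> u u' v; rewrite !big_cons !big_nil !addr0 /=; exact: (linD (fl v)).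
- by move=> u v v'; rewrite !big_cons !big_nil !addr0 /=; exact: (linD (fr u)).
- by move=> a u v; rewrite !big_seq1 /= (linZ a (fl v)) (linZ a (fr u)).
Qed.

Lemma tlift_sum U V W (f : U -> V -> W) s : bilin f ->
  tlift f (tsum s) = \sum_(p <- s) f p.1 p.2.
Proof. by move=> bf; apply: teq_big => //; exact: teq_repr. Qed.

Lemma tlift_tens U V W (f : U -> V -> W) u v : bilin f ->
  tlift f (u ⊗ v) = f u v.
Proof. by move=> bf; rewrite tlift_sum // big_seq1. Qed.

Lemma tlift_linear U V W (f : U -> V -> W) : bilin f -> linear (tlift f).
Proof.
move=> bf a x y; rewrite -(tsumK x) -(tsumK y).
rewrite -[_ + _]/(tadd (tscale a _) _) tscale_sum tadd_sum !tlift_sum //.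
rewrite big_cat big_map /= scaler_sumr; congr (_ + _); apply: eq_bigr => p _.
by rewrite (linZ a (bf.1 p.2)).
Qed.

Lemma tlift_fun U V W W' (f : W' -> U -> V -> W) t :
  (forall u v, linear (fun x => f x u v)) -> linear (fun x => tlift (f x) t).
Proof.
move=> lf a x y; rewrite /tlift scaler_sumr -big_split /=.
by apply: eq_bigr => p _; rewrite lf.
Qed.

Lemma lin_comp U V W (f : V -> W) (g : U -> V) :
  linear f -> linear g -> linear (fun x => f (g x)).
Proof. by move=> lf lg a x y; rewrite lg lf. Qed.

Lemma lin_id U : linear (fun x : U => x).
Proof. by []. Qed.

Lemma lin_tensl U V W (g : W -> U) (v : V) :
  linear g -> linear (fun x => g x ⊗ v).
Proof. by move=> lg; apply: (lin_comp (f := (@tens k U V)^~ v)) lg; exact: (bilin_tens U V).1. Qed.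

Lemma lin_tensr U V W (g : W -> V) (u : U) :
  linear g -> linear (fun x => u ⊗ g x).
Proof. by move=> lg; apply: (lin_comp (f := tens u)) lg; exact: (bilin_tens U V).2. Qed.

Lemma lin_tlift U V W W' (f : U -> V -> W) (g : W' -> U ⊗ V) :
  bilin f -> linear g -> linear (fun x => tlift f (g x)).
Proof. by move=> bf lg; apply: (lin_comp (tlift_linear bf)). Qed.

Lemma lin_app U V (f : {linear U -> V}) W (g : W -> U) :
  linear g -> linear (fun x => f (g x)).
Proof. by apply: lin_comp; exact: linearP. Qed.

Lemma lin_scalel W' W (g : W' -> k^o) (w : W) :
  linear g -> linear (fun x => g x *: w).
Proof. by move=> lg a x y; rewrite lg scalerDl scalerA. Qed.

Lemma lin_scaler W' W (g : W' -> W) (c : k) :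
  linear g -> linear (fun x => c *: g x).
Proof. by move=> lg a x y; rewrite lg scalerDr !scalerA mulrC. Qed.

Lemma bilinI U V W (f : U -> V -> W) :
  (forall v, linear (f^~ v)) -> (forall u, linear (f u)) -> bilin f.
Proof. by []. Qed.

End TensorTheory.

(* Sweedler-style sum: if t = sum_i u_i ⊗ v_i and F is bilinear in (u, v), then
   \sw_(u # v <- t) F is sum_i F[u_i, v_i]. *)
Notation "\sw_ ( u # v <- t ) F" := (tlift (fun u v => F) t) : ring_scope.

Ltac lin_tac :=
  repeat first [ exact: lin_id | assumption | apply: bilinI => ? /=
    | apply: lin_tensl | apply: lin_tensr | apply: lin_tlift
    | apply: tlift_fun => ? ? /= | apply: lin_app
    | apply: lin_scalel | apply: lin_scaler ].

Definition tassoc (k : fieldType) (U V W : lmodType k)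
    (t : ((U ⊗ V) ⊗ W)%type) : (U ⊗ (V ⊗ W))%type :=
  \sw_(s # w <- t) \sw_(u # v <- s) u ⊗ (v ⊗ w).

Definition tmap (k : fieldType) (U U' V V' : lmodType k)
    (f : U -> U') (g : V -> V') (t : (U ⊗ V)%type) : (U' ⊗ V')%type :=
  \sw_(u # v <- t) f u ⊗ g v.

HB.mixin Record isCoalgebra (k : fieldType) X of GRing.Lmodule k X := {
  comult : {linear X -> ((X : lmodType k) ⊗ (X : lmodType k))%type};
  counit : {linear X -> k^o};
  comultA : forall x : X,
    tassoc (\sw_(x1 # x2 <- comult x) comult x1 ⊗ x2)
    = \sw_(x1 # x2 <- comult x) x1 ⊗ comult x2;
  counitl : forall x : X, \sw_(x1 # x2 <- comult x) (counit x1 : k) *: x2 = x;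
  counitr : forall x : X, \sw_(x1 # x2 <- comult x) (counit x2 : k) *: x1 = x
}.

#[short(type="coalgType")]
HB.structure Definition Coalgebra (k : fieldType) :=
  { X of isCoalgebra k X & GRing.Lmodule k X }.

Definition coalg_morphism (k : fieldType) (X Y : coalgType k) (f : X -> Y) :=
  [/\ linear f,
      forall x, comult (f x) = tmap f f (comult x) &
      forall x, counit (f x) = counit x].

(* X^cop: the coalgebra X with comultiplication x |-> x_(2) ⊗ x_(1). *)
Definition cop (T : Type) : Type := T.

Section Cop.
Variables (k : fieldType) (X : coalgType k).

HB.instance Definition _ := GRing.Lmodule.on (cop X).

Definition cop_comult (x : cop X) : (cop X ⊗ cop X)%type :=
  \sw_(x1 # x2 <- @comult k X x) (x2 : cop X) ⊗ (x1 : cop X).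

Definition cop_counit (x : cop X) : k^o := @counit k X x.

Lemma cop_comult_linear : linear cop_comult.
Proof. by rewrite /cop_comult; lin_tac. Qed.

Lemma cop_counit_linear : linear cop_counit.
Proof. exact: linearP. Qed.

HB.instance Definition _ :=
  GRing.isLinear.Build k (cop X) (cop X ⊗ cop X)%type *:%R cop_comult
    cop_comult_linear.
HB.instance Definition _ :=
  GRing.isLinear.Build k (cop X) k^o *:%R cop_counit cop_counit_linear.

Let flip (t : (X ⊗ X)%type) : (X ⊗ X)%type := \sw_(a # b <- t) b ⊗ a.

Lemma cop_comultA (x : cop X) :
  tassoc (\sw_(x1 # x2 <- cop_comult x) cop_comult x1 ⊗ x2)
  = \sw_(x1 # x2 <- cop_comult x) x1 ⊗ cop_comult x2.
Proof.
pose cm := @comult k X : {linear X -> (X ⊗ X)%type}.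
rewrite -[LHS]/(tassoc (\sw_(x1 # x2 <- flip (cm x)) flip (cm x1) ⊗ x2)).
rewrite -[RHS]/(\sw_(x1 # x2 <- flip (cm x)) x1 ⊗ flip (cm x2)).
pose r (t : (X ⊗ (X ⊗ X))%type) : (X ⊗ (X ⊗ X))%type :=
  \sw_(a # s <- t) \sw_(b # c <- s) c ⊗ (b ⊗ a).
have h1 t : tassoc (\sw_(x1 # x2 <- flip t) flip (cm x1) ⊗ x2)
    = r (\sw_(x1 # x2 <- t) x1 ⊗ cm x2).
  move: t; apply: linear_ext; rewrite /r /tassoc /flip; try by lin_tac.
  move=> u v; rewrite !tlift_tens; try by lin_tac.
  move: (cm v); apply: linear_ext; try by lin_tac.
  by move=> a b; rewrite !tlift_tens //; lin_tac.
have h2 t : \sw_(x1 # x2 <- flip t) x1 ⊗ flip (cm x2)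
    = r (tassoc (\sw_(x1 # x2 <- t) cm x1 ⊗ x2)).
  move: t; apply: linear_ext; rewrite /r /tassoc /flip; try by lin_tac.
  move=> u v; rewrite !tlift_tens; try by lin_tac.
  move: (cm u); apply: linear_ext; try by lin_tac.
  by move=> a b; rewrite !tlift_tens //; lin_tac.
by rewrite h1 h2 comultA.
Qed.

Lemma cop_counitl (x : cop X) :
  \sw_(x1 # x2 <- cop_comult x) (cop_counit x1 : k) *: x2 = x.
Proof.
pose ep := @counit k X : {linear X -> k^o}.
rewrite -[LHS]/(\sw_(x1 # x2 <- flip (@comult k X x)) ((ep x1 : k) *: (x2 : X))).
rewrite -[RHS](@counitr k X); move: (comult _).
apply: linear_ext; rewrite /flip; try by lin_tac.
by move=> u v; rewrite !tlift_tens //; lin_tac.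
Qed.

Lemma cop_counitr (x : cop X) :
  \sw_(x1 # x2 <- cop_comult x) (cop_counit x2 : k) *: x1 = x.
Proof.
pose ep := @counit k X : {linear X -> k^o}.
rewrite -[LHS]/(\sw_(x1 # x2 <- flip (@comult k X x)) ((ep x2 : k) *: (x1 : X))).
rewrite -[RHS](@counitl k X); move: (comult _).
apply: linear_ext; rewrite /flip; try by lin_tac.
by move=> u v; rewrite !tlift_tens //; lin_tac.
Qed.

HB.instance Definition _ := isCoalgebra.Build k (cop X)
  cop_comultA cop_counitl cop_counitr.
End Cop.

Section TensorCoalgebra.
Variables (k : fieldType) (X Y : coalgType k).
Local Notation T := (X ⊗ Y)%type.

(* x ⊗ y |-> (x_(1) ⊗ y_(1)) ⊗ (x_(2) ⊗ y_(2)) *)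
Definition tens_comult (t : T) : (T ⊗ T)%type :=
  \sw_(x # y <- t) \sw_(x1 # x2 <- comult x) \sw_(y1 # y2 <- comult y)
    (x1 ⊗ y1) ⊗ (x2 ⊗ y2).

Definition tens_counit (t : T) : k^o :=
  \sw_(x # y <- t) (counit x * counit y).

Lemma lin_mull (W' : lmodType k) (g : W' -> k^o) (w : k^o) :
  linear g -> linear (fun x => g x * w : k^o).
Proof. by move=> lg a x y; rewrite lg mulrDl -mulrA. Qed.

Lemma lin_mulr (W' : lmodType k) (g : W' -> k^o) (w : k^o) :
  linear g -> linear (fun x => w * g x : k^o).
Proof. by move=> lg a x y; rewrite lg mulrDr mulrCA. Qed.

Lemma tens_comult_linear : linear tens_comult.
Proof. by rewrite /tens_comult; lin_tac. Qed.

Lemma bilin_counit : bilin (fun (x : X) (y : Y) => counit x * counit y : k^o).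
Proof.
split=> [y|x]; [apply: lin_mull|apply: lin_mulr]; exact: linearP.
Qed.

Lemma tens_counit_linear : linear tens_counit.
Proof. apply: tlift_linear; exact: bilin_counit. Qed.

HB.instance Definition _ :=
  GRing.isLinear.Build k T (T ⊗ T)%type *:%R tens_comult tens_comult_linear.
HB.instance Definition _ :=
  GRing.isLinear.Build k T k^o *:%R tens_counit tens_counit_linear.

Let tau (a : (X ⊗ X)%type) (b : (Y ⊗ Y)%type) : (T ⊗ T)%type :=
  \sw_(x1 # x2 <- a) \sw_(y1 # y2 <- b) (x1 ⊗ y1) ⊗ (x2 ⊗ y2).

Let P3 (a : (X ⊗ (X ⊗ X))%type) (b : (Y ⊗ (Y ⊗ Y))%type) :
    (T ⊗ (T ⊗ T))%type :=
  \sw_(x1 # a' <- a) \sw_(y1 # b' <- b) (x1 ⊗ y1) ⊗ tau a' b'.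

Lemma tens_comult_tens x y : tens_comult (x ⊗ y) = tau (comult x) (comult y).
Proof. by rewrite /tens_comult tlift_tens //; lin_tac. Qed.

Lemma tens_comultA (t : T) :
  tassoc (\sw_(x1 # x2 <- tens_comult t) tens_comult x1 ⊗ x2)
  = \sw_(x1 # x2 <- tens_comult t) x1 ⊗ tens_comult x2.
Proof.
pose cX := @comult k X : {linear X -> (X ⊗ X)%type}.
pose cY := @comult k Y : {linear Y -> (Y ⊗ Y)%type}.
pose cT := tens_comult : {linear T -> (T ⊗ T)%type}.
have hr a b : \sw_(x1 # x2 <- tau a b) x1 ⊗ cT x2
   = P3 (\sw_(x1 # x2 <- a) x1 ⊗ cX x2) (\sw_(x1 # x2 <- b) x1 ⊗ cY x2).
  move: a; apply: linear_ext; rewrite /P3 /tau; try by lin_tac.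
  move=> a1 a2; rewrite !tlift_tens; try by lin_tac.
  move: b; apply: linear_ext; try by lin_tac.
  move=> b1 b2; rewrite !tlift_tens; try by lin_tac.
  by rewrite /cT /= tens_comult_tens.
have hl a b : tassoc (\sw_(x1 # x2 <- tau a b) cT x1 ⊗ x2)
   = P3 (tassoc (\sw_(x1 # x2 <- a) cX x1 ⊗ x2))
        (tassoc (\sw_(x1 # x2 <- b) cY x1 ⊗ x2)).
  move: a; apply: linear_ext; rewrite /P3 /tau /tassoc; try by lin_tac.
  move=> a1 a2; rewrite !tlift_tens; try by lin_tac.
  move: b; apply: linear_ext; try by lin_tac.
  move=> b1 b2; rewrite !tlift_tens; try by lin_tac.
  rewrite /cT /= tens_comult_tens /tau -/cX -/cY.
  move: (cX a1); apply: linear_ext; try by lin_tac.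
  move=> c1 c2; rewrite !tlift_tens; try by lin_tac.
  move: (cY b1); apply: linear_ext; try by lin_tac.
  by move=> d1 d2; rewrite !tlift_tens //; lin_tac.
move: t; apply: linear_ext; rewrite -/cT; rewrite /tassoc; try by lin_tac.
move=> x y; rewrite /cT /= tens_comult_tens; rewrite -/(tassoc _).
by rewrite hl hr !comultA.
Qed.

Lemma tens_counitl (t : T) :
  \sw_(x1 # x2 <- tens_comult t) (tens_counit x1 : k) *: x2 = t.
Proof.
pose cT := tens_comult : {linear T -> (T ⊗ T)%type}.
pose eT := tens_counit : {linear T -> k^o}.
pose eX := @counit k X : {linear X -> k^o}.
pose eY := @counit k Y : {linear Y -> k^o}.
rewrite -[LHS]/(\sw_(x1 # x2 <- cT t) (eT x1 : k) *: x2).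
move: t; apply: linear_ext; try by lin_tac.
move=> x y; rewrite /cT /= tens_comult_tens.
rewrite -{2}(counitl x) -{2}(counitl y); move: (comult x) (comult y) => a b.
rewrite -[LHS]/(\sw_(x1 # x2 <- tau a b) (eT x1 : k) *: x2) -/eX -/eY.
move: a; apply: linear_ext; rewrite /tau; try by lin_tac.
move=> a1 a2; rewrite !tlift_tens; try by lin_tac.
move: b; apply: linear_ext; try by lin_tac.
move=> b1 b2; rewrite !tlift_tens; try by lin_tac.
rewrite /eT /= /tens_counit tlift_tens; last exact: bilin_counit.
by rewrite tensZl tensZr scalerA.
Qed.

Lemma tens_counitr (t : T) :
  \sw_(x1 # x2 <- tens_comult t) (tens_counit x2 : k) *: x1 = t.
Proof.
pose cT := tens_comult : {linear T -> (T ⊗ T)%type}.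
pose eT := tens_counit : {linear T -> k^o}.
pose eX := @counit k X : {linear X -> k^o}.
pose eY := @counit k Y : {linear Y -> k^o}.
rewrite -[LHS]/(\sw_(x1 # x2 <- cT t) (eT x2 : k) *: x1).
move: t; apply: linear_ext; try by lin_tac.
move=> x y; rewrite /cT /= tens_comult_tens.
rewrite -{2}(counitr x) -{2}(counitr y); move: (comult x) (comult y) => a b.
rewrite -[LHS]/(\sw_(x1 # x2 <- tau a b) (eT x2 : k) *: x1) -/eX -/eY.
move: a; apply: linear_ext; rewrite /tau; try by lin_tac.
move=> a1 a2; rewrite !tlift_tens; try by lin_tac.
move: b; apply: linear_ext; try by lin_tac.
move=> b1 b2; rewrite !tlift_tens; try by lin_tac.
rewrite /eT /= /tens_counit tlift_tens; last exact: bilin_counit.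
by rewrite tensZl tensZr scalerA.
Qed.

HB.instance Definition _ := isCoalgebra.Build k T
  tens_comultA tens_counitl tens_counitr.
End TensorCoalgebra.

Section QMagma.
Variables (k : fieldType) (X : coalgType k).
Variables dot colon : {linear (X ⊗ X)%type -> X}.

(* h(x ⊗ y) = y_(1) : x_(2) ⊗ x_(1) . y_(2); the Sweedler components of y refer
   to the comultiplication of X, not to that of X^cop. *)
Definition qm_h (t : (X ⊗ cop X)%type) : (cop X ⊗ X)%type :=
  \sw_(x # y <- t) \sw_(x1 # x2 <- comult x) \sw_(y1 # y2 <- @comult k X y)
    (colon (y1 ⊗ x2) : cop X) ⊗ dot (x1 ⊗ y2).

Definition qmagma_coalgebra :=
  [/\ forall x y, counit (dot (x ⊗ y)) = counit x * counit y,
      forall x y, counit (colon (x ⊗ y)) = counit x * counit y &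
      coalg_morphism qm_h].

Definition qm_Gbar (t : (X ⊗ X)%type) : (X ⊗ X)%type :=
  \sw_(x # y <- t) \sw_(y1 # y2 <- comult y) dot (x ⊗ y1) ⊗ y2.

(* The inverse of a bijective linear map is linear (see [qm_Gbar_inv_linear]),
   so invertibility in the category of vector spaces is bijectivity. *)
Definition left_regular := bijective qm_Gbar.

(* The inverse of Gbar, with a junk value 0 outside its image. *)
Definition qm_Gbar_inv (t : (X ⊗ X)%type) : (X ⊗ X)%type :=
  xget 0 [set u | qm_Gbar u = t].

(* x^y and ^x y; X ⊗ k is identified with X, so that X ⊗ counit is
   a ⊗ b |-> counit b *: a. *)
Definition qm_rpow (x y : X) : X :=
  \sw_(a # b <- qm_Gbar_inv (x ⊗ y)) (counit b : k) *: a.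

Definition qm_lpow (x y : X) : X :=
  \sw_(y1 # y2 <- comult y) colon (y2 ⊗ qm_rpow x y1).

Definition qm_s (t : (X ⊗ X)%type) : (X ⊗ X)%type :=
  \sw_(x # y <- t) \sw_(x1 # x2 <- comult x) \sw_(y1 # y2 <- comult y)
    qm_lpow x2 y2 ⊗ qm_rpow x1 y1.

Lemma qm_Gbar_linear : linear qm_Gbar.
Proof. by rewrite /qm_Gbar; lin_tac. Qed.

Lemma qm_GbarK : left_regular -> cancel qm_Gbar qm_Gbar_inv.
Proof.
move=> [g gK _] t; rewrite /qm_Gbar_inv.
case: xgetP => [u _ /= h|/(_ t) []//].
by rewrite -(gK u) h gK.
Qed.

Lemma qm_Gbar_invK : left_regular -> cancel qm_Gbar_inv qm_Gbar.
Proof.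
by move=> reg t; have [g _ Kg] := reg; rewrite -{1}(Kg t) qm_GbarK ?Kg.
Qed.

Lemma qm_Gbar_inv_linear : left_regular -> linear qm_Gbar_inv.
Proof.
move=> reg a x y; rewrite -{1}(qm_Gbar_invK reg x) -{1}(qm_Gbar_invK reg y).
by rewrite -qm_Gbar_linear qm_GbarK.
Qed.

Lemma qm_h_tens (x y : X) : qm_h (x ⊗ (y : cop X)) =
  \sw_(x1 # x2 <- comult x) \sw_(y1 # y2 <- comult y)
    (colon (y1 ⊗ x2) : cop X) ⊗ dot (x1 ⊗ y2).
Proof. by rewrite /qm_h tlift_tens //; lin_tac. Qed.

Lemma qm_Gbar_tens (x y : X) : qm_Gbar (x ⊗ y) =
  \sw_(y1 # y2 <- comult y) dot (x ⊗ y1) ⊗ y2.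
Proof. by rewrite /qm_Gbar tlift_tens //; lin_tac. Qed.

Lemma qm_s_tens (x y : X) : left_regular -> qm_s (x ⊗ y) =
  \sw_(x1 # x2 <- comult x) \sw_(y1 # y2 <- comult y)
    qm_lpow x2 y2 ⊗ qm_rpow x1 y1.
Proof.
move=> reg; rewrite /qm_s tlift_tens //; rewrite /qm_lpow /qm_rpow.
lin_tac; by apply: (lin_comp (qm_Gbar_inv_linear reg)); lin_tac.
Qed.
End QMagma.

Section NonDegenerate.
Variables (k : fieldType) (X : coalgType k).
Variable s : (X ⊗ X)%type -> (X ⊗ X)%type.

(* s_2 = (counit ⊗ X) o s, with k ⊗ X identified with X. *)
Definition snd_comp (t : (X ⊗ X)%type) : X :=
  \sw_(a # b <- s t) (counit a : k) *: b.

Definition G_map (t : (X ⊗ X)%type) : (X ⊗ X)%type :=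
  \sw_(x # y <- t) \sw_(y1 # y2 <- comult y) snd_comp (x ⊗ y1) ⊗ y2.

Definition left_nondegenerate := bijective G_map.
End NonDegenerate.

(* Main.v *)
Require Import Defs.
From HB Require Import structures.
From mathcomp Require Import all_boot all_algebra.

Set Implicit Arguments.
Unset Strict Implicit.
Unset Printing Implicit Defensive.

Import GRing.Theory.
Local Open Scope ring_scope.

(** Write x.y and x:y for the two operations and G for Gbar. Projecting the
    identity Delta o h = (h ⊗ h) o Delta onto the tensor factors, which are the
    two operations up to order, gives three identities:
      Delta(x.y) = x1.y2 ⊗ x2.y1      Delta(x:y) = x1:y2 ⊗ x2:y1
      y1:x2 ⊗ x1.y2 = y2:x1 ⊗ x2.y1
    ([comult_dot], [comult_colon], [colon_dot_exchange]).

    Since G is onto, every claim on s can be tested on the elements G(x ⊗ y).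
    There the definition of x^y by the inverse of G becomes transparent: the map
    r : x ⊗ y |-> x^y satisfies r o G = X ⊗ epsilon, and therefore
      s(G(x ⊗ y)) = (y:x2) ⊗ x1,
    an expression free of inverses ([qm_s_Gbar]). The tool which gives it is
      Delta(G(x ⊗ y)) = G(x1 ⊗ y2) ⊗ (x2.y1 ⊗ y3)
    ([comult_Gbar]), because s(t) is obtained from Delta(t) by applying r to the
    first factor and the left power map to the second ([qm_sE]).

    By [comult_Gbar] again, (s ⊗ s)(Delta(G(x ⊗ y))) is
      ((y2:x2) ⊗ x1) ⊗ s(x3.y1 ⊗ y3),
    where the third identity above changes y2:x2 and x3.y1 into y1:x3 and x2.y2;
    what remains under s is then G(x2 ⊗ y2), and the result is
      ((y1:x4) ⊗ x1) ⊗ ((y2:x3) ⊗ x2) = Delta((y:x2) ⊗ x1).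
    Finally the second component of s is r ([snd_comp_qm_s]), so that G_s is the
    inverse of G ([G_map_qm_s]). *)

(** * Sweedler calculus *)

(** Linearity of an explicit expression, by its shape. Named linear maps are
    tried before [tlift], since a map defined through [tlift] would otherwise be
    unfolded, possibly down to a body on which no rule applies. *)
Ltac lin_solve :=
  repeat first [ exact: lin_id | assumption | apply: bilinI => ? /=
    | apply: lin_app | apply: lin_tensl | apply: lin_tensr | apply: lin_tlift
    | apply: tlift_fun => ? ? /= | apply: lin_scalel | apply: lin_scaler ].

Section Sweedler.
Variable k : fieldType.
Implicit Types U V W : lmodType k.

(** A Sweedler sum is a finite sum over a representative of the tensor, so
    [eq_sw], [exchange_sw] and [lin_sw] ask no bilinearity of the summand. *)
Lemma eq_sw U V W (F G : U -> V -> W) t :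
  (forall u v, F u v = G u v) -> \sw_(u # v <- t) F u v = \sw_(u # v <- t) G u v.
Proof. by move=> FG; apply: eq_bigr => p _; exact: FG. Qed.

Lemma exchange_sw U V U' V' W (F : U -> V -> U' -> V' -> W) t t' :
  \sw_(u # v <- t) \sw_(u' # v' <- t') F u v u' v'
  = \sw_(u' # v' <- t') \sw_(u # v <- t) F u v u' v'.
Proof. exact: exchange_big. Qed.

Lemma lin_sw U V W W' (g : W -> W') (lg : linear g) (F : U -> V -> W) t :
  g (\sw_(u # v <- t) F u v) = \sw_(u # v <- t) g (F u v).
Proof. exact: (big_morph g (linD lg) (lin0 lg)). Qed.

Lemma sw_sw U V U' V' W (F : U' -> V' -> W) (G : U -> V -> (U' ⊗ V')%type) t :
  bilin F ->
  \sw_(u' # v' <- \sw_(u # v <- t) G u v) F u' v'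
  = \sw_(u # v <- t) \sw_(u' # v' <- G u v) F u' v'.
Proof. by move=> bF; apply: lin_sw; exact: tlift_linear. Qed.

Lemma sw_tens U V W (F : U -> V -> W) u v : bilin F ->
  \sw_(a # b <- u ⊗ v) F a b = F u v.
Proof. exact: tlift_tens. Qed.

Lemma sw_id U V (t : (U ⊗ V)%type) : \sw_(u # v <- t) u ⊗ v = t.
Proof.
by move: t; apply: linear_ext; lin_solve => u v; rewrite sw_tens //; lin_solve.
Qed.

Lemma tmap_linear U U' V V' (f : U -> U') (g : V -> V') :
  linear f -> linear g -> linear (tmap f g).
Proof.
by move=> lf lg; apply: tlift_linear; split=> ?; [apply: lin_tensl|apply: lin_tensr].
Qed.

Lemma tmap_tens U U' V V' (f : U -> U') (g : V -> V') u v :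
  linear f -> linear g -> tmap f g (u ⊗ v) = f u ⊗ g v.
Proof.
by move=> lf lg; rewrite /tmap sw_tens //; split=> ?;
   [apply: lin_tensl|apply: lin_tensr].
Qed.

Lemma tmap_comp U U' U'' V V' V'' (f : U' -> U'') (f' : U -> U')
    (g : V' -> V'') (g' : V -> V') t :
  linear f -> linear g ->
  tmap f g (tmap f' g' t) = tmap (f \o f') (g \o g') t.
Proof.
move=> lf lg; rewrite [tmap f' g' t]/tmap lin_sw; last exact: tmap_linear.
by apply: eq_sw => u v; rewrite tmap_tens.
Qed.

Section Coalg.
Variable X : coalgType k.
Implicit Types x y : X.

(** Coassociativity in the form used to renumber Sweedler components: it applies
    to any trilinear summand. *)
Lemma coassoc W (F : X -> X -> X -> W) x :
  (forall b c, linear (fun a => F a b c)) ->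
  (forall a c, linear (fun b => F a b c)) ->
  (forall a b, linear (fun c => F a b c)) ->
  \sw_(x1 # x2 <- comult x) \sw_(a # b <- comult x1) F a b x2
  = \sw_(x1 # x2 <- comult x) \sw_(b # c <- comult x2) F x1 b c.
Proof.
move=> l1 l2 l3.
have b1 a : bilin (F a) by split.
have b2 : bilin (fun a (s : (X ⊗ X)%type) => \sw_(b # c <- s) F a b c).
  by split=> [s|a]; [apply: tlift_fun | apply: tlift_linear].
have b3 c : bilin (fun a b => F a b c) by split.
pose T := tlift (fun a (s : (X ⊗ X)%type) => \sw_(b # c <- s) F a b c).
have lT : linear T by exact: tlift_linear.
have hl t : T (tassoc (\sw_(x1 # x2 <- t) comult x1 ⊗ x2))
    = \sw_(x1 # x2 <- t) \sw_(a # b <- comult x1) F a b x2.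
  rewrite /tassoc sw_sw ?lin_sw //; last by lin_solve.
  apply: eq_sw => u v; rewrite sw_tens ?lin_sw //; last by lin_solve.
  by apply: eq_sw => a b; rewrite /T !sw_tens.
rewrite -hl comultA lin_sw //.
by apply: eq_sw => u v; rewrite /T sw_tens.
Qed.

Lemma sw_counitl W (F : X -> W) x : linear F ->
  \sw_(x1 # x2 <- comult x) (counit x1 : k) *: F x2 = F x.
Proof.
move=> lF; rewrite -{2}(counitl x) lin_sw //.
by apply: eq_sw => u v; rewrite (linZ _ lF).
Qed.

Lemma sw_counitr W (F : X -> W) x : linear F ->
  \sw_(x1 # x2 <- comult x) (counit x2 : k) *: F x1 = F x.
Proof.
move=> lF; rewrite -{2}(counitr x) lin_sw //.
by apply: eq_sw => u v; rewrite (linZ _ lF).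
Qed.

End Coalg.

Lemma comult_tens (A B : coalgType k) (a : A) (b : B) :
  comult (a ⊗ b) = \sw_(a1 # a2 <- comult a) \sw_(b1 # b2 <- comult b)
    (a1 ⊗ b1) ⊗ (a2 ⊗ b2).
Proof. exact: tens_comult_tens. Qed.

Lemma counit_tens (A B : coalgType k) (a : A) (b : B) :
  counit (a ⊗ b) = counit a * counit b.
Proof. by rewrite [LHS]sw_tens //; exact: bilin_counit. Qed.

Lemma comult_cop (X : coalgType k) (x : X) :
  @comult k (cop X) x = \sw_(x1 # x2 <- comult x) (x2 : cop X) ⊗ (x1 : cop X).
Proof. by []. Qed.

Section Proj.
Variables A B : coalgType k.

Definition proj1 (t : (A ⊗ B)%type) : A := \sw_(a # b <- t) (counit b : k) *: a.
Definition proj2 (t : (A ⊗ B)%type) : B := \sw_(a # b <- t) (counit a : k) *: b.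

Lemma proj1_linear : linear proj1. Proof. by rewrite /proj1; lin_solve. Qed.
Lemma proj2_linear : linear proj2. Proof. by rewrite /proj2; lin_solve. Qed.

HB.instance Definition _ :=
  GRing.isLinear.Build k (A ⊗ B)%type A *:%R proj1 proj1_linear.
HB.instance Definition _ :=
  GRing.isLinear.Build k (A ⊗ B)%type B *:%R proj2 proj2_linear.

Lemma proj1_tens a b : proj1 (a ⊗ b) = (counit b : k) *: a.
Proof. by rewrite /proj1 sw_tens //; lin_solve. Qed.
Lemma proj2_tens a b : proj2 (a ⊗ b) = (counit a : k) *: b.
Proof. by rewrite /proj2 sw_tens //; lin_solve. Qed.

Lemma counit_proj1 t : counit (proj1 t) = counit t.
Proof.
move: t; apply: linear_ext; [by lin_solve | by lin_solve |] => a b.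
by rewrite proj1_tens counit_tens linearZ mulrC.
Qed.

Lemma counit_proj2 t : counit (proj2 t) = counit t.
Proof.
move: t; apply: linear_ext; [by lin_solve | by lin_solve |] => a b.
by rewrite proj2_tens counit_tens linearZ.
Qed.

Let eA := @counit k A : {linear A -> k^o}.
Let eB := @counit k B : {linear B -> k^o}.

Lemma tmap_proj1 t : tmap proj1 proj1 (comult t) = comult (proj1 t).
Proof.
have lp : linear (tmap proj1 proj1) by apply: tmap_linear; lin_solve.
move: t; apply: linear_ext; [by lin_solve | by lin_solve |] => a b.
rewrite proj1_tens comult_tens linearZ /= -[in RHS](sw_id (comult a)) !(lin_sw lp).
rewrite (lin_sw (g := fun c => (counit b : k) *: c)); last by lin_solve.
apply: eq_sw => a1 a2; rewrite (lin_sw lp).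
rewrite -(sw_counitr (F := fun c => (eB c : k) *: (a1 ⊗ a2))); last by lin_solve.
apply: eq_sw => b1 b2; rewrite tmap_tens; try by lin_solve.
by rewrite !proj1_tens tensZl tensZr scalerA mulrC -scalerA.
Qed.

Lemma tmap_proj2 t : tmap proj2 proj2 (comult t) = comult (proj2 t).
Proof.
have lp : linear (tmap proj2 proj2) by apply: tmap_linear; lin_solve.
move: t; apply: linear_ext; [by lin_solve | by lin_solve |] => a b.
rewrite proj2_tens comult_tens linearZ /= -[in RHS](sw_id (comult b)) (lin_sw lp).
rewrite -(sw_counitr (F := fun c => (eA c : k) *: \sw_(u # v <- comult b) u ⊗ v));
  last by lin_solve.
apply: eq_sw => a1 a2; rewrite (lin_sw lp).
rewrite (lin_sw (g := fun c => (counit a2 : k) *: ((eA a1 : k) *: c)));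
  last by lin_solve.
apply: eq_sw => b1 b2; rewrite tmap_tens; try by lin_solve.
by rewrite !proj2_tens tensZl tensZr scalerA mulrC -scalerA.
Qed.

(** With [tmap_proj1] and [tmap_proj2], this recovers an element of a tensor
    product of coalgebras, and its comultiplication, from the two projections. *)
Lemma tmap_proj12 t : tmap proj1 proj2 (comult t) = t.
Proof.
have lp : linear (tmap proj1 proj2) by apply: tmap_linear; lin_solve.
move: t; apply: linear_ext; [by lin_solve | by lin_solve |] => a b.
rewrite comult_tens (lin_sw lp).
rewrite -(sw_counitr (F := fun c => c ⊗ b)); last by lin_solve.
apply: eq_sw => a1 a2; rewrite (lin_sw lp).
rewrite -(sw_counitl (F := fun c => (counit a2 : k) *: (a1 ⊗ c))); last by lin_solve.
apply: eq_sw => b1 b2; rewrite tmap_tens; try by lin_solve.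
by rewrite proj1_tens proj2_tens tensZl tensZr.
Qed.

End Proj.
End Sweedler.

(** * The coalgebra structure behind a q-magma coalgebra *)

Lemma tmap_comult_cop (k : fieldType) (X : coalgType k) (V W : lmodType k)
    (f : (X ⊗ cop X)%type -> V) (g : (X ⊗ cop X)%type -> W) (x y : X) :
  linear f -> linear g ->
  tmap f g (comult (x ⊗ (y : cop X)))
  = \sw_(x1 # x2 <- comult x) \sw_(y1 # y2 <- comult y)
      f (x1 ⊗ (y2 : cop X)) ⊗ g (x2 ⊗ (y1 : cop X)).
Proof.
move=> lf lg; have lfg := tmap_linear lf lg.
rewrite comult_tens comult_cop (lin_sw lfg); apply: eq_sw => x1 x2.
rewrite sw_sw; last by lin_solve.
rewrite (lin_sw lfg); apply: eq_sw => y1 y2.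
by rewrite sw_tens; [rewrite tmap_tens | lin_solve].
Qed.

Section QMagmaTheory.
Variables (k : fieldType) (X : coalgType k).
Variables dot colon : {linear (X ⊗ X)%type -> X}.
Hypothesis qm : qmagma_coalgebra dot colon.

Lemma counit_dot x y : counit (dot (x ⊗ y)) = counit x * counit y.
Proof. by case: qm. Qed.

Lemma counit_colon x y : counit (colon (x ⊗ y)) = counit x * counit y.
Proof. by case: qm. Qed.

Local Notation h := (qm_h dot colon).

(** The operations are the components of h, in the order imposed by [cop]: the
    identities below are projections of Delta o h = (h ⊗ h) o Delta. *)
Lemma proj1_qm_h (x y : X) : proj1 (h (x ⊗ (y : cop X))) = colon (y ⊗ x).
Proof.
rewrite qm_h_tens (lin_sw (linP _)).
rewrite -(sw_counitl (F := fun x2 => colon (y ⊗ x2))); last by lin_solve.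
apply: eq_sw => x1 x2; rewrite (lin_sw (linP _)).
rewrite -(sw_counitr (F := fun y1 => (counit x1 : k) *: colon (y1 ⊗ x2)));
  last by lin_solve.
apply: eq_sw => y1 y2.
by rewrite /= proj1_tens counit_dot scalerA mulrC.
Qed.

Lemma proj2_qm_h (x y : X) : proj2 (h (x ⊗ (y : cop X))) = dot (x ⊗ y).
Proof.
rewrite qm_h_tens (lin_sw (linP _)).
rewrite -(sw_counitr (F := fun x1 => dot (x1 ⊗ y))); last by lin_solve.
apply: eq_sw => x1 x2; rewrite (lin_sw (linP _)).
rewrite -(sw_counitl (F := fun y2 => (counit x2 : k) *: dot (x1 ⊗ y2)));
  last by lin_solve.
apply: eq_sw => y1 y2; rewrite /= proj2_tens -[counit _]/(@counit k X (colon (y1 ⊗ x2))).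
by rewrite counit_colon scalerA.
Qed.

Lemma qm_h_linear : linear h. Proof. by case: qm => _ _ []. Qed.

Lemma comult_qm_h t : comult (h t) = tmap h h (comult t).
Proof. by case: qm => _ _ []. Qed.

Lemma comult_dot x y : comult (dot (x ⊗ y)) =
  \sw_(x1 # x2 <- comult x) \sw_(y1 # y2 <- comult y)
    dot (x1 ⊗ y2) ⊗ dot (x2 ⊗ y1).
Proof.
have lh := qm_h_linear.
rewrite -proj2_qm_h -tmap_proj2 comult_qm_h tmap_comp; try by lin_solve.
rewrite tmap_comult_cop; try by apply: lin_comp => //; lin_solve.
by apply: eq_sw => x1 x2; apply: eq_sw => y1 y2; rewrite /= !proj2_qm_h.
Qed.

(** The first projection of h lands in [cop X], so both sides are flipped to
    return to the comultiplication of [X]. *)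
Lemma comult_colon (x y : X) : comult (colon (y ⊗ x)) =
  \sw_(x1 # x2 <- comult x) \sw_(y1 # y2 <- comult y)
    colon (y1 ⊗ x2) ⊗ colon (y2 ⊗ x1).
Proof.
have lh := qm_h_linear.
have : @comult k (cop X) (proj1 (h (x ⊗ (y : cop X)))) =
    \sw_(x1 # x2 <- comult x) \sw_(y1 # y2 <- comult y)
      (colon (y2 ⊗ x1) : cop X) ⊗ (colon (y1 ⊗ x2) : cop X).
  rewrite -tmap_proj1 comult_qm_h tmap_comp; try by lin_solve.
  rewrite tmap_comult_cop; try by apply: lin_comp => //; lin_solve.
  by apply: eq_sw => x1 x2; apply: eq_sw => y1 y2; rewrite /= !proj1_qm_h.
rewrite proj1_qm_h comult_cop.
move/(congr1 (fun t => \sw_(a # b <- t) (b : X) ⊗ (a : X))).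
have lf : linear (fun t : (X ⊗ X)%type => \sw_(a # b <- t) b ⊗ a) by lin_solve.
rewrite !(lin_sw lf) => E; apply: etrans (etrans E _).
  rewrite -[LHS]sw_id; apply: eq_sw => a b; by rewrite sw_tens //; lin_solve.
apply: eq_sw => x1 x2; rewrite (lin_sw lf); apply: eq_sw => y1 y2.
by rewrite sw_tens //; lin_solve.
Qed.

(** The compatibility of the two operations: h itself is rebuilt from the
    projections of Delta o h, with the Sweedler components interchanged. *)
Lemma colon_dot_exchange (x y : X) :
  \sw_(x1 # x2 <- comult x) \sw_(y1 # y2 <- comult y)
    colon (y1 ⊗ x2) ⊗ dot (x1 ⊗ y2)
  = \sw_(x1 # x2 <- comult x) \sw_(y1 # y2 <- comult y)
    colon (y2 ⊗ x1) ⊗ dot (x2 ⊗ y1).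
Proof.
have lh := qm_h_linear.
apply: etrans (_ : (h (x ⊗ (y : cop X)) : (X ⊗ X)%type) = _).
  by rewrite qm_h_tens.
rewrite -[h _]tmap_proj12 comult_qm_h tmap_comp; try by lin_solve.
rewrite tmap_comult_cop; try by apply: lin_comp => //; lin_solve.
apply: eq_sw => x1 x2; apply: eq_sw => y1 y2.
by rewrite /= proj1_qm_h proj2_qm_h.
Qed.

End QMagmaTheory.

(** * The solution attached to a left regular q-magma coalgebra *)

Section LeftRegular.
Variables (k : fieldType) (X : coalgType k).
Variables dot colon : {linear (X ⊗ X)%type -> X}.
Hypothesis qm : qmagma_coalgebra dot colon.
Hypothesis reg : left_regular dot.

Local Notation Gbar := (qm_Gbar dot).
HB.instance Definition _ :=
  GRing.isLinear.Build k (X ⊗ X)%type (X ⊗ X)%type *:%R Gbar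
    (@qm_Gbar_linear k X dot).

(** The inverse of Gbar is linear only when Gbar is bijective; the proof of
    bijectivity is made an argument so that linearity can be a canonical
    instance. *)
Definition Gbar_inv_map of left_regular dot := qm_Gbar_inv dot.

HB.instance Definition _ :=
  GRing.isLinear.Build k (X ⊗ X)%type (X ⊗ X)%type *:%R (Gbar_inv_map reg)
    (qm_Gbar_inv_linear reg).

Definition rpow_map (r : left_regular dot) (t : (X ⊗ X)%type) : X :=
  proj1 (Gbar_inv_map r t).

Local Notation rpow := (rpow_map reg).

Lemma rpow_linear : linear rpow.
Proof. by rewrite /rpow_map; lin_solve. Qed.

HB.instance Definition _ :=
  GRing.isLinear.Build k (X ⊗ X)%type X *:%R rpow rpow_linear.

(** This replaces the inverse of Gbar in all later computations. *)
Lemma rpow_Gbar t : rpow (Gbar t) = proj1 t.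
Proof. by rewrite /rpow_map /Gbar_inv_map qm_GbarK. Qed.

Definition lpow_map (t : (X ⊗ X)%type) : X :=
  \sw_(x # y <- t) \sw_(y1 # y2 <- comult y) colon (y2 ⊗ rpow (x ⊗ y1)).

Local Notation lpow := lpow_map.

Lemma lpow_linear : linear lpow.
Proof. by rewrite /lpow_map; lin_solve. Qed.

HB.instance Definition _ :=
  GRing.isLinear.Build k (X ⊗ X)%type X *:%R lpow lpow_linear.

Lemma lpow_tens x y : lpow (x ⊗ y) = qm_lpow dot colon x y.
Proof. by rewrite /lpow_map sw_tens //; lin_solve. Qed.

Local Notation s := (qm_s dot colon).

Lemma qm_sE t : s t = \sw_(u # v <- comult t) lpow v ⊗ rpow u.
Proof.
have l : linear (fun c : ((X ⊗ X) ⊗ (X ⊗ X))%type =>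
  \sw_(u # v <- c) lpow v ⊗ rpow u) by lin_solve.
have lc : linear (fun t : (X ⊗ X)%type =>
  \sw_(u # v <- comult t) lpow v ⊗ rpow u) by lin_solve.
rewrite -[in RHS](sw_id t) (lin_sw lc).
apply: eq_sw => x y; rewrite comult_tens (lin_sw l).
apply: eq_sw => x1 x2; rewrite (lin_sw l).
apply: eq_sw => y1 y2; rewrite sw_tens; last by lin_solve.
by rewrite lpow_tens.
Qed.

Lemma qm_s_linear : linear s.
Proof.
have l : linear (fun t : (X ⊗ X)%type =>
  \sw_(u # v <- comult t) lpow v ⊗ rpow u) by lin_solve.
by move=> a u v; rewrite !qm_sE l.
Qed.

HB.instance Definition _ :=
  GRing.isLinear.Build k (X ⊗ X)%type (X ⊗ X)%type *:%R s qm_s_linear.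

(** In a fourfold comultiplication of y, the twist in [comult_dot] multiplies x1 by
    y2, which stands next to y3: the first tensor factor is again a value of Gbar. *)
Lemma comult_Gbar x y : comult (Gbar (x ⊗ y)) =
  \sw_(x1 # x2 <- comult x) \sw_(y1 # y' <- comult y)
    \sw_(y2 # y3 <- comult y') Gbar (x1 ⊗ y2) ⊗ (dot (x2 ⊗ y1) ⊗ y3).
Proof.
rewrite qm_Gbar_tens (lin_sw (linP _)) /=.
transitivity (\sw_(a # b <- comult y) \sw_(x1 # x2 <- comult x)
  \sw_(a1 # a2 <- comult a) \sw_(c # d <- comult b)
    (dot (x1 ⊗ a2) ⊗ c) ⊗ (dot (x2 ⊗ a1) ⊗ d)).
  apply: eq_sw => a b; rewrite comult_tens (comult_dot qm) sw_sw; last by lin_solve.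
  apply: eq_sw => x1 x2; rewrite sw_sw; last by lin_solve.
  by apply: eq_sw => a1 a2; rewrite sw_tens //; lin_solve.
rewrite [LHS]exchange_sw; apply: eq_sw => x1 x2.
rewrite (coassoc (F := fun a1 a2 b => \sw_(c # d <- comult b)
  (dot (x1 ⊗ a2) ⊗ c) ⊗ (dot (x2 ⊗ a1) ⊗ d))); try by move=> *; lin_solve.
apply: eq_sw => y1 y'.
rewrite -(coassoc (F := fun c d e =>
  (dot (x1 ⊗ c) ⊗ d) ⊗ (dot (x2 ⊗ y1) ⊗ e))); try by move=> *; lin_solve.
apply: eq_sw => y2 y3.
have l : linear (fun u : (X ⊗ X)%type => u ⊗ (dot (x2 ⊗ y1) ⊗ y3)) by lin_solve.
by rewrite qm_Gbar_tens (lin_sw l).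
Qed.

(** By coassociativity, the right power inside the left one meets a value of
    Gbar. *)
Lemma lpow_Gbar x y : lpow (Gbar (x ⊗ y)) = colon (y ⊗ x).
Proof.
rewrite qm_Gbar_tens (lin_sw (linP _)) /=.
transitivity (\sw_(a # b <- comult y) \sw_(b1 # b2 <- comult b)
   colon (b2 ⊗ rpow (dot (x ⊗ a) ⊗ b1))).
  by apply: eq_sw => a b; rewrite lpow_tens.
rewrite -(sw_counitl (F := fun b => colon (b ⊗ x))); last by lin_solve.
rewrite -(coassoc (F := fun a b c => colon (c ⊗ rpow (dot (x ⊗ a) ⊗ b))));
  try by move=> *; lin_solve.
apply: eq_sw => a b.
have l : linear (fun u => colon (b ⊗ rpow u)) by lin_solve.
rewrite -(lin_sw l) -qm_Gbar_tens rpow_Gbar proj1_tens.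
by rewrite tensZr linearZ.
Qed.

(** In [comult_Gbar] the right power undoes the first factor by [rpow_Gbar]; the
    remaining component of y rebuilds Gbar for the left power. *)
Lemma qm_s_Gbar x y :
  s (Gbar (x ⊗ y)) = \sw_(x1 # x2 <- comult x) colon (y ⊗ x2) ⊗ x1.
Proof.
rewrite qm_sE comult_Gbar sw_sw; last by lin_solve.
apply: eq_sw => x1 x2; rewrite sw_sw; last by lin_solve.
have l : linear (fun u => lpow u ⊗ x1) by lin_solve.
rewrite -lpow_Gbar qm_Gbar_tens (lin_sw l); apply: eq_sw => y1 y'.
rewrite sw_sw; last by lin_solve.
rewrite -(sw_counitl (F := fun c => lpow (dot (x2 ⊗ y1) ⊗ c) ⊗ x1));
  last by lin_solve.
apply: eq_sw => y2 y3; rewrite sw_tens; last by lin_solve.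
by rewrite rpow_Gbar proj1_tens tensZr.
Qed.

(** On the image of Gbar, Delta o s and (s ⊗ s) o Delta are compared through this
    expression, in which c, u, v, e are the components x1, x2, x3, x4 of x. *)
Lemma comult_qm_s_Gbar x y : comult (s (Gbar (x ⊗ y))) =
  \sw_(c # x' <- comult x) \sw_(d # e <- comult x')
    \sw_(y1 # y2 <- comult y) \sw_(u # v <- comult d)
      (colon (y1 ⊗ e) ⊗ c) ⊗ (colon (y2 ⊗ v) ⊗ u).
Proof.
rewrite qm_s_Gbar (lin_sw (linP _)) /=.
transitivity (\sw_(x1 # x2 <- comult x) \sw_(c # d <- comult x1)
  \sw_(u # v <- comult x2) \sw_(y1 # y2 <- comult y)
    (colon (y1 ⊗ v) ⊗ c) ⊗ (colon (y2 ⊗ u) ⊗ d)).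
  apply: eq_sw => x1 x2; rewrite comult_tens (comult_colon qm) [RHS]exchange_sw.
  rewrite sw_sw; last by lin_solve.
  apply: eq_sw => u v; rewrite [RHS]exchange_sw sw_sw; last by lin_solve.
  by apply: eq_sw => y1 y2; rewrite sw_tens //; lin_solve.
rewrite (coassoc (F := fun c d x2 => \sw_(u # v <- comult x2)
  \sw_(y1 # y2 <- comult y)
    (colon (y1 ⊗ v) ⊗ c) ⊗ (colon (y2 ⊗ u) ⊗ d))); try by move=> *; lin_solve.
apply: eq_sw => c x'.
rewrite -(coassoc (F := fun d u v => \sw_(y1 # y2 <- comult y)
    (colon (y1 ⊗ v) ⊗ c) ⊗ (colon (y2 ⊗ u) ⊗ d))); try by move=> *; lin_solve.
by apply: eq_sw => d e; rewrite [LHS]exchange_sw.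
Qed.

(** The components of y occur as y2, y1, y3: [colon_dot_exchange] brings them in
    order, after which y2 and y3 are absorbed by Gbar. *)
Lemma tmap_qm_s_Gbar x y : tmap s s (comult (Gbar (x ⊗ y))) =
  \sw_(c # x' <- comult x) \sw_(d # e <- comult x')
    \sw_(y1 # y2 <- comult y) \sw_(u # v <- comult d)
      (colon (y1 ⊗ e) ⊗ c) ⊗ (colon (y2 ⊗ v) ⊗ u).
Proof.
have lss : linear (tmap s s) by apply: tmap_linear; lin_solve.
rewrite comult_Gbar (lin_sw lss).
transitivity (\sw_(x1 # x2 <- comult x) \sw_(c # d <- comult x1)
  \sw_(y' # y3 <- comult y) \sw_(y1 # y2 <- comult y')
    (colon (y2 ⊗ d) ⊗ c) ⊗ s (dot (x2 ⊗ y1) ⊗ y3)).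
  apply: eq_sw => x1 x2; rewrite (lin_sw lss) [RHS]exchange_sw.
  under [RHS]eq_sw do rewrite exchange_sw.
  rewrite (coassoc (F := fun y1 y2 y3 => \sw_(c # d <- comult x1)
    (colon (y2 ⊗ d) ⊗ c) ⊗ s (dot (x2 ⊗ y1) ⊗ y3))); try by move=> *; lin_solve.
  apply: eq_sw => y1 y'; rewrite (lin_sw lss); apply: eq_sw => y2 y3.
  rewrite tmap_tens; try by lin_solve.
  have l : linear (fun a : (X ⊗ X)%type => a ⊗ s (dot (x2 ⊗ y1) ⊗ y3)) by lin_solve.
  by rewrite qm_s_Gbar (lin_sw l).
rewrite (coassoc (F := fun c d e => \sw_(y' # y3 <- comult y)
  \sw_(y1 # y2 <- comult y')
    (colon (y2 ⊗ d) ⊗ c) ⊗ s (dot (e ⊗ y1) ⊗ y3))); try by move=> *; lin_solve.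
apply: eq_sw => c x'.
transitivity (\sw_(d # e <- comult x') \sw_(y' # y3 <- comult y)
  \sw_(y1 # y2 <- comult y')
    (colon (y1 ⊗ e) ⊗ c) ⊗ s (dot (d ⊗ y2) ⊗ y3)).
  rewrite [LHS]exchange_sw [RHS]exchange_sw; apply: eq_sw => y' y3.
  have l : linear (fun t : (X ⊗ X)%type =>
    \sw_(a # b <- t) (a ⊗ c) ⊗ s (b ⊗ y3)) by lin_solve.
  have := congr1 (fun t : (X ⊗ X)%type =>
    \sw_(a # b <- t) (a ⊗ c) ⊗ s (b ⊗ y3)) (colon_dot_exchange qm x' y').
  rewrite !(lin_sw l) => E; symmetry; apply: etrans (etrans E _);
    apply: eq_sw => d e; rewrite (lin_sw l); apply: eq_sw => y1 y2;
    by rewrite sw_tens //; lin_solve.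
apply: eq_sw => d e.
rewrite (coassoc (F := fun y1 y2 y3 =>
  (colon (y1 ⊗ e) ⊗ c) ⊗ s (dot (d ⊗ y2) ⊗ y3))); try by move=> *; lin_solve.
apply: eq_sw => y1 y2.
have l : linear (fun a : (X ⊗ X)%type => (colon (y1 ⊗ e) ⊗ c) ⊗ a) by lin_solve.
have ls : linear (fun a : (X ⊗ X)%type => (colon (y1 ⊗ e) ⊗ c) ⊗ s a) by lin_solve.
by rewrite -[in RHS](lin_sw l) -qm_s_Gbar qm_Gbar_tens (lin_sw ls).
Qed.

Lemma comult_qm_s t : comult (s t) = tmap s s (comult t).
Proof.
have lss : linear (tmap s s) by apply: tmap_linear; lin_solve.
rewrite -(qm_Gbar_invK reg t); move: (qm_Gbar_inv _ _).
apply: linear_ext; [by lin_solve | by lin_solve |] => x y.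
by rewrite comult_qm_s_Gbar tmap_qm_s_Gbar.
Qed.

(** The counit of the colon factor in [qm_s_Gbar] leaves epsilon(y) x, which is
    also the value of the right power on Gbar(x ⊗ y). *)
Lemma snd_comp_qm_s t : snd_comp s t = rpow t.
Proof.
rewrite -[LHS]/(proj2 (s t)) -(qm_Gbar_invK reg t) rpow_Gbar; move: (qm_Gbar_inv _ _).
apply: linear_ext; [by lin_solve | by lin_solve |] => x y.
rewrite qm_s_Gbar (lin_sw (linP _)) proj1_tens.
rewrite -(sw_counitr (F := fun x1 => (counit y : k) *: x1)); last by lin_solve.
apply: eq_sw => x1 x2.
by rewrite /= proj2_tens (counit_colon qm) scalerA mulrC.
Qed.

Lemma counit_Gbar t : counit (Gbar t) = counit t.
Proof.
move: t; apply: linear_ext; [by lin_solve | by lin_solve |] => x y.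
have E : proj2 (Gbar (x ⊗ y)) = (counit x : k) *: y.
  rewrite qm_Gbar_tens (lin_sw (linP _)).
  rewrite -(sw_counitl (F := fun y2 => (counit x : k) *: y2)); last by lin_solve.
  by apply: eq_sw => y1 y2; rewrite /= proj2_tens (counit_dot qm) scalerA mulrC.
by rewrite counit_tens -counit_proj2 E linearZ.
Qed.

Lemma counit_qm_s t : counit (s t) = counit t.
Proof.
rewrite -counit_proj2 -[proj2 _]/(snd_comp s t) snd_comp_qm_s.
by rewrite -(qm_Gbar_invK reg t) rpow_Gbar counit_proj1 counit_Gbar.
Qed.

Lemma G_map_qm_s t : G_map s (Gbar t) = t.
Proof.
have E u : G_map s u = \sw_(x # y <- u) \sw_(y1 # y2 <- comult y)
    rpow (x ⊗ y1) ⊗ y2.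
  by apply: eq_sw => x y; apply: eq_sw => y1 y2; rewrite snd_comp_qm_s.
rewrite E; move: t; apply: linear_ext; [by lin_solve | by lin_solve |] => x y.
rewrite qm_Gbar_tens sw_sw; last by lin_solve.
transitivity (\sw_(a # b <- comult y) \sw_(b1 # b2 <- comult b)
   rpow (dot (x ⊗ a) ⊗ b1) ⊗ b2).
  by apply: eq_sw => a b; rewrite sw_tens //; lin_solve.
rewrite -(coassoc (F := fun a b c => rpow (dot (x ⊗ a) ⊗ b) ⊗ c));
  try by move=> *; lin_solve.
rewrite -(sw_counitl (F := fun b => x ⊗ b)); last by lin_solve.
apply: eq_sw => a b; have l : linear (fun u => rpow u ⊗ b) by lin_solve.
by rewrite -(lin_sw l) -qm_Gbar_tens rpow_Gbar proj1_tens tensZl.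
Qed.

End LeftRegular.

Theorem proposition2p7 (k : fieldType) (X : coalgType k)
    (dot colon : {linear (X ⊗ X)%type -> X}) :
  qmagma_coalgebra dot colon -> left_regular dot ->
  coalg_morphism (qm_s dot colon) /\ left_nondegenerate (qm_s dot colon).
Proof.
move=> qm reg; split.
  split; [exact: qm_s_linear | exact: comult_qm_s | exact: counit_qm_s].
exists (qm_Gbar dot) => t; last exact: G_map_qm_s.
by rewrite -{1}(qm_Gbar_invK reg t) G_map_qm_s // qm_Gbar_invK.
Qed.
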